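(* Let $p$ be a prime, let $k\geq 2$ be an integer, let $f\in F_p[x]$ be an irreducible polynomial of degree $k$, and let $K_f=F_p[x]/(f)$ be the corresponding field with $p^k$ elements. Then the undirected graph $X_f$ associated to $K_f$ is connected, is Eulerian, has girth $2$, and has diameter at most $2p(2k+1)-2k-4$.
   Context: $F_p$ is the field with $p$ elements, and the class of the polynomial $x$ in $K_f=F_p[x]/(f)$ is again denoted $x$. Let $S=\{x,x^p,x^{p^2},\dots,x^{p^{k-1}}\}\subset K_f$ be the orbit of $x$ under the Frobenius automorphism $y\mapsto y^p$. The directed multigraph $\overrightarrow{X}_f$ has vertex set $K_f$ and the following edges. For all $y,z\in K_f$ and $s\in S$ with $z-y=s$ there is one (additive) edge from $y$ to $z$ corresponding to $s$. For all $y,z\in K_f\setminus\{0\}$ and $s\in S$ with $zy^{-1}=s$ there is one (multiplicative) edge from $y$ to $z$ corresponding to $s$. The undirected multigraph $X_f$ is obtained by forgetting the orientations of edges while keeping every edge (so multiple edges may occur). The girth is the length of a shortest closed path (cycle) in the multigraph: a loop is a closed path of length $1$, and two distinct edges joining the same two distinct vertices form a closed path of length $2$. Eulerian means having a closed walk that traverses every edge exactly once. The diameter is the maximum over pairs of vertices of the length (number of edges) of a shortest path joining them. *)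

(* Defs.v *)
From HB Require Import structures.
From mathcomp Require Import all_boot all_order all_algebra all_fingroup all_field.

Set Implicit Arguments.
Unset Strict Implicit.
Unset Printing Implicit Defensive.

Import GRing.Theory.
Local Open Scope ring_scope.

(* Finite multigraphs, with edges as first-class objects so that parallel     *)
(* edges and loops are allowed.                                               *)

Record dmultigraph := DMultigraph {
  dvertex : finType;
  dedge : finType;
  src : dedge -> dvertex;
  tgt : dedge -> dvertex
}.

(* The set of ends of an edge has one element exactly when it is a loop. *)
Record multigraph := Multigraph {
  vertex : finType;
  edge : finType;
  ends : edge -> {set vertex};
  card_ends : forall e, (0 < #|ends e| <= 2)%N
}.

Section Undirected.

Variable D : dmultigraph.

Definition undirected_ends (e : dedge D) : {set dvertex D} :=
  [set src e; tgt e].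

Fact card_undirected_ends (e : dedge D) :
  (0 < #|undirected_ends e| <= 2)%N.
Proof. by rewrite cards2; case: (_ != _). Qed.

Definition undirected : multigraph := Multigraph card_undirected_ends.

End Undirected.

Section Multigraph.

Variable G : multigraph.
Implicit Types (u v : vertex G) (w : seq (edge G * vertex G)).

(* The sequence (e1, v1), ..., (en, vn) stands for the walk                   *)
(* u -e1- v1 -e2- ... -en- vn of length n, whose initial vertex u is given    *)
(* separately.                                                                *)
Fixpoint is_walk u w : bool :=
  if w is (e, v) :: w' then (ends e == [set u; v]) && is_walk v w' else true.

Definition walk_edges w : seq (edge G) := unzip1 w.
Definition walk_vertices w : seq (vertex G) := unzip2 w.
Definition walk_end u w : vertex G := last u (walk_vertices w).

Definition is_path u v w : bool :=
  [&& is_walk u w, walk_end u w == v & uniq (u :: walk_vertices w)].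

Definition is_closed_walk u w : bool := is_walk u w && (walk_end u w == u).

(* u itself occurs in walk_vertices w, as its last item. *)
Definition is_cycle u w : bool :=
  [&& (0 < size w)%N, is_closed_walk u w, uniq (walk_edges w)
    & uniq (walk_vertices w)].

Definition connected : Prop := forall u v, exists w, is_path u v w.

Definition eulerian : Prop :=
  exists u w,
    is_closed_walk u w /\ forall e, count_mem e (walk_edges w) = 1%N.

Definition has_girth (g : nat) : Prop :=
  (exists u w, is_cycle u w /\ size w = g) /\
  (forall u w, is_cycle u w -> (g <= size w)%N).

Definition is_distance u v (d : nat) : Prop :=
  (exists w, is_path u v w /\ size w = d) /\
  (forall w, is_path u v w -> (d <= size w)%N).

Definition has_diameter (d : nat) : Prop :=
  (exists u v, is_distance u v d) /\
  (forall u v, exists2 d', is_distance u v d' & (d' <= d)%N).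

End Multigraph.

Section QuotientFieldGraph.

Variables (p : nat) (f : {poly 'F_p}).

(* The library only forms quotients by monic polynomials; normalizing f does  *)
(* not change the ideal (f).                                                  *)
Definition monic_of : {poly 'F_p} := (lead_coef f)^-1 *: f.

Hypothesis fI : irreducible_poly f.

Fact monic_of_irreducible : monic_irreducible_poly monic_of.
Proof.
have f0 : f != 0 by case: fI => + _; apply: contraTneq => ->; rewrite size_poly0.
have c0 : (lead_coef f)^-1 != 0 by rewrite invr_eq0 lead_coef_eq0.
split; last by rewrite monicE lead_coefZ mulVf // lead_coef_eq0.
case: fI => f1 fq; split=> [|q q1]; first by rewrite size_scale.
rewrite /monic_of dvdpZr // => /(fq q q1) qf.
by rewrite (eqp_trans qf) // eqp_sym eqp_scale.
Qed.

Definition Kf : finFieldType := {poly %/ monic_of with monic_of_irreducible}.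

Definition x_f : Kf := in_qpoly monic_of 'X.

Definition S_f : {set Kf} := [set x_f ^+ (p ^ i) | i : 'I_(size f).-1].

(* Edges are indexed by triples (y, z, s). *)
Definition additive_edge (t : Kf * Kf * Kf) : bool :=
  let: (y, z, s) := t in (s \in S_f) && (z - y == s).

Definition multiplicative_edge (t : Kf * Kf * Kf) : bool :=
  let: (y, z, s) := t in [&& y != 0, z != 0, s \in S_f & z * y^-1 == s].

Definition Xf_edge : finType :=
  ({t : Kf * Kf * Kf | additive_edge t} + {t : Kf * Kf * Kf | multiplicative_edge t})%type.

Definition edge_triple (e : Xf_edge) : Kf * Kf * Kf :=
  match e with inl a => val a | inr m => val m end.

Definition directed_Xf : dmultigraph :=
  @DMultigraph Kf Xf_edge
    (fun e => (edge_triple e).1.1) (fun e => (edge_triple e).1.2).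

Definition Xf : multigraph := undirected directed_Xf.

End QuotientFieldGraph.

(* Main.v *)
(** Any permutation of the edges sending each edge to one that starts where it
ends decomposes the graph into closed trails. Such a permutation exists here,
because one can keep adding, or keep multiplying by, the same [s]. Two closed
trails through a common vertex merge after composition with a transposition, so
in a connected graph a permutation with the fewest cycles has only one, which is
an Eulerian circuit.

No edge is a loop because [0] and [1] are not in [S], and [y = x / (x - 1)]
satisfies [y + x = y * x], which gives two parallel edges.

Since [x, x^2, ..., x^k] is a basis, Horner's scheme reaches every element from
[0] by at most [k (p - 1)] additions of [x] and [k - 1] multiplications by [x].
Hence the diameter is at most [2 (k p - 1)], which is smaller than the bound of
the theorem by [2 (p - 1) (k + 1)]. *)

Require Import Defs.
From mathcomp Require Import all_boot all_order all_algebra all_fingroup all_field.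
From mathcomp Require Import zify.

Set Implicit Arguments.
Unset Strict Implicit.
Unset Printing Implicit Defensive.

Import GRing.Theory.

(** * Walks of bounded length, distances and diameter *)

Section Walks.

Variable G : multigraph.
Implicit Types (u v t : vertex G) (w : seq (edge G * vertex G)) (n : nat).

(** Repeated vertices and a mere upper bound on the length make this relation compose freely; simple
    paths are extracted only at the end. *)
Definition walk_within u v n : Prop :=
  exists w, [/\ is_walk u w, walk_end u w = v & size w <= n].

Lemma walk_within_refl u n : walk_within u u n.
Proof. by exists [::]. Qed.

Lemma walk_within_edge (e : edge G) u v :
  ends e = [set u; v] -> walk_within u v 1.
Proof. by move=> ee; exists [:: (e, v)]; rewrite /= ee eqxx. Qed.

Lemma walk_within_leq u v m n :
  m <= n -> walk_within u v m -> walk_within u v n.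
Proof. by move=> mn [w [ww wv wm]]; exists w; split=> //; apply: leq_trans mn. Qed.

Lemma walk_within_trans v u t m n :
  walk_within u v m -> walk_within v t n -> walk_within u t (m + n).
Proof.
case=> w1; elim: w1 u m => [|[e u1] w1 IH] u m [/=].
  move=> _ <- _ vt; exact: walk_within_leq (leq_addl _ _) vt.
case/andP=> ee ww we; case: m => // m wm vt.
have [w [ww' we' wn]] := IH u1 m (And3 ww we wm) vt.
by exists ((e, u1) :: w); rewrite /= ee.
Qed.

Lemma walk_within_sym u v n : walk_within u v n -> walk_within v u n.
Proof.
case=> w; elim: w u n => [|[e u1] w IH] u n [/=].
  by move=> _ <- _; apply: walk_within_refl.
case/andP=> /eqP ee ww we; case: n => // n wn.
rewrite -addn1; apply: walk_within_trans (IH u1 n (And3 ww we wn)) _.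
by apply: (walk_within_edge (e := e)); rewrite setUC.
Qed.

Lemma path_suffix u v t w :
  is_path v t w -> u \in v :: walk_vertices w ->
  exists2 w', is_path u t w' & size w' <= size w.
Proof.
elim: w v => [|[e v1] w IH] v pw.
  by rewrite inE => /eqP ->; exists [::].
rewrite inE => /orP[/eqP -> | uw]; first by exists ((e, v1) :: w).
have pw' : is_path v1 t w.
  by case/and3P: pw => /= /andP[_ ww] we /andP[_ uq]; apply/and3P.
by have [w' pw'' ws] := IH _ pw' uw; exists w' => //; apply: leqW.
Qed.

(** Induction on the walk: if [u] already lies on the simple path built from the next vertex, the
    part of that path from [u] on replaces it; otherwise the first edge is prepended. *)
Lemma walk_within_path u v n :
  walk_within u v n -> exists2 w, is_path u v w & size w <= n.
Proof.
case=> w; elim: w u n => [|[e u1] w IH] u n [/=].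
  by move=> _ <- _; exists [::]; rewrite // /is_path /= eqxx.
case/andP=> ee ww we; case: n => // n wn.
have [w' pw' ws] := IH u1 n (And3 ww we wn).
have [uw | uw] := boolP (u \in u1 :: walk_vertices w').
  have [w'' pw'' ws'] := path_suffix pw' uw.
  by exists w'' => //; apply: leq_trans ws' (leqW ws).
exists ((e, u1) :: w') => //.
by case/and3P: pw' => ww' we' uq; apply/and3P; split; rewrite //= ?ee //; apply/andP.
Qed.

Lemma walk_within_distance u v n :
  walk_within u v n -> exists2 d, is_distance u v d & d <= n.
Proof.
move=> /walk_within_path[w0 pw0 w0n].
(* Tuples of a fixed length form a finite type, so [P] is boolean, as [ex_minn] requires. *)
pose P d := [exists w : d.-tuple (edge G * vertex G), is_path u v w].
have Pw w : is_path u v w -> P (size w).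
  by move=> pw; apply/existsP; exists (in_tuple w).
have exP : exists d, P d by exists (size w0); apply: Pw.
exists (ex_minn exP); case: ex_minnP => d /existsP[w pw] dmin.
  split; first by exists w; rewrite size_tuple.
  by move=> w' /Pw/dmin.
by apply: leq_trans w0n; apply/dmin/Pw.
Qed.

Lemma walk_within_diameter u0 n :
  (forall u v, walk_within u v n) -> exists2 d, has_diameter G d & d <= n.
Proof.
move=> wn.
have /fin_all_exists[dist distP] (uv : vertex G * vertex G) :
    exists d, is_distance uv.1 uv.2 d /\ d <= n.
  by have [d ? ?] := walk_within_distance (wn uv.1 uv.2); exists d.
have V0 : 0 < #|{: vertex G * vertex G}| by apply/card_gt0P; exists (u0, u0).
have [[u v] maxE] := eq_bigmax dist V0.
exists (\max_uv dist uv); last by rewrite maxE; case: (distP (u, v)).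
split=> [|u1 v1]; first by exists u, v; rewrite maxE; case: (distP (u, v)).
exists (dist (u1, v1)); first by case: (distP (u1, v1)).
exact: (leq_bigmax (u1, v1)).
Qed.

End Walks.

(** * Eulerian circuits from edge permutations, and girth *)

Section DirectedGraphs.

Variable D : dmultigraph.
Let G := undirected D.
Implicit Types (e : dedge D) (s : {perm dedge D}).

Definition is_succession s : bool := [forall e, src (s e) == tgt e].

Lemma succession_min s : is_succession s ->
  exists2 s', is_succession s' &
    forall e1 e2, tgt e1 = tgt e2 -> e2 \in porbit s' e1.
Proof.
move=> succ_s.
have [s' succ_s' min_s'] := arg_minnP (fun s => #|porbits s|) succ_s.
exists s' => // e1 e2 te; apply: contraT; rewrite porbit_sym => e12.
have /min_s' : is_succession (tperm e1 e2 * s').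
  apply/forallP=> e; rewrite permM (eqP (forallP succ_s' _)).
  by case: tpermP => // ->; rewrite te.
(* As [e1] and [e2] lie in different orbits, the transposition merges these and lowers the number of
   orbits, against minimality. *)
have := porbits_mul_tperm s' e1 e2; rewrite /= e12.
by case: (e1 != e2) => /=; lia.
Qed.

Lemma porbit_connected s :
    is_succession s ->
    (forall e1 e2, tgt e1 = tgt e2 -> e2 \in porbit s e1) ->
    connected G -> forall e1 e2, e2 \in porbit s e1.
Proof.
move=> succ_s tgt_s conn.
(* An edge leaving [v] shares its orbit with its predecessor, which ends at [v]. So all edges at
   [v], of either direction, lie in one orbit, and the orbit is constant along walks. *)
have to_tgt (v : dvertex D) e : v \in undirected_ends e ->
    exists2 e', tgt e' = v & porbit s e' = porbit s e.
  rewrite !inE => /orP[]/eqP->; last by exists e.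
  exists ((s^-1)%g e); first by rewrite -(eqP (forallP succ_s _)) permKV.
  by have := porbit_perm s 1 ((s^-1)%g e); rewrite expg1 permKV.
have incident (v : dvertex D) e1 e2 : v \in undirected_ends e1 ->
    v \in undirected_ends e2 -> porbit s e1 = porbit s e2.
  move=> /to_tgt[e1' t1 <-] /to_tgt[e2' t2 <-]; apply/esym/eqP.
  by rewrite eq_porbit_mem tgt_s // t1.
have along w : forall (u : vertex G) e1 e2, is_walk u w ->
    u \in undirected_ends e1 -> walk_end u w \in undirected_ends e2 ->
    porbit s e1 = porbit s e2.
  elim: w => [|[e v] w IH] u e1 e2 /=; first by move=> _; apply: incident.
  case/andP=> /eqP ee ww ue1 we2.
  rewrite (@incident u e1 e) //; last by rewrite ee set21.
  by apply: IH ww _ we2; rewrite ee set22.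
move=> e1 e2; have [w /and3P[ww /eqP we _]] := conn (src e1) (src e2).
rewrite -eq_porbit_mem eq_sym; apply/eqP/(along w _ _ _ ww); first exact: set21.
by rewrite we; exact: set21.
Qed.

Lemma eulerian_of_succession s e0 :
  is_succession s -> connected G -> eulerian G.
Proof.
move=> /succession_min[{}s succ_s tgt_s] conn.
have all_s := porbit_connected succ_s tgt_s conn.
pose trail n e : seq (edge G * vertex G) :=
  [seq (e', tgt e') | e' <- traject s e n].
have trail_walk n : forall e, is_walk (src e : vertex G) (trail n e).
  elim: n => //= n IH e; rewrite eqxx /=.
  by rewrite -[tgt e](eqP (forallP succ_s e)); apply: IH.
have trail_end n : forall e, walk_end (src e : vertex G) (trail n e) = src (iter n s e).
  elim: n => //= n IH e; rewrite /walk_end /= -/(walk_end _ (trail n (s e))).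
  by rewrite -[tgt e](eqP (forallP succ_s e)) IH -iterSr.
(* Iterating [s] as many times as the orbit has elements returns to [e0], which closes the trail. *)
exists (src e0), (trail #|porbit s e0| e0); split.
  by rewrite /is_closed_walk trail_walk trail_end iter_porbit eqxx.
move=> e; have -> : walk_edges (trail #|porbit s e0| e0) = traject s e0 #|porbit s e0|.
  by rewrite /walk_edges /unzip1 -map_comp map_id_in.
rewrite count_uniq_mem ?uniq_traject_porbit //.
by rewrite -porbit_traject all_s.
Qed.

Lemma has_girth2_of_parallel e1 e2 :
    (forall e, src e != tgt e) -> e1 != e2 ->
    src e1 = src e2 -> tgt e1 = tgt e2 ->
  has_girth G 2.
Proof.
move=> noloop e12 s12 t12; split.
  exists (src e1), [:: (e1, tgt e1); (e2, src e1)]; split=> //.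
  rewrite /is_cycle /is_closed_walk /walk_end /= /undirected_ends -s12 -t12.
  rewrite [[set tgt e1; src e1]]setUC !eqxx /= !inE e12 eq_sym.
  by rewrite (noloop e1).
(* Only length one is left to exclude: such a cycle is a loop, whose set of ends is a singleton. *)
move=> u [|[e v] [|//]] // /and4P[_ /andP[/=]].
rewrite /walk_end /= andbT => /eqP ee /eqP vu _ _.
have := cards2 (src e) (tgt e); rewrite -/(undirected_ends e).
by rewrite ee vu setUid cards1 noloop.
Qed.

End DirectedGraphs.

(** The Frobenius map is an injective ring morphism; this keeps 1 out of the orbit of [x]. *)
Lemma expf_pchar_eq1 (F : fieldType) p (x : F) i :
  p \in [pchar F]%R -> (x ^+ (p ^ i) == 1)%R = (x == 1)%R.
Proof.
move=> pF; elim: i => [|i IH]; first by rewrite expr1.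
by rewrite expnSr exprM -(pFrobenius_autE pF) fmorph_eq1.
Qed.

(** * The graph of the quotient field *)

Section QuotientFieldGraph.

Local Open Scope ring_scope.

Context (p : nat) (f : {poly 'F_p}) (fI : irreducible_poly f).

Let K := Kf fI.
Let G := Xf fI.
Let x : K := x_f fI.
Let cls (q : {poly 'F_p}) : K := in_qpoly (monic_of f) q.

Implicit Types (y z s : K) (t : K * K * K) (e : Xf_edge fI) (q : {poly 'F_p}).

Definition additive_next t : K * K * K := (t.1.2, t.1.2 + t.2, t.2).
Definition multiplicative_next t : K * K * K := (t.1.2, t.1.2 * t.2, t.2).

Lemma additive_edge_add y s : s \in S_f fI -> additive_edge (y, y + s, s).
Proof. by move=> sS; rewrite /= sS addrC addKr eqxx. Qed.

Lemma multiplicative_edge_mul y s :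
  s \in S_f fI -> s != 0 -> y != 0 -> multiplicative_edge (y, y * s, s).
Proof. by move=> sS s0 y0; rewrite /= y0 sS mulf_neq0 //= mulrAC divff ?mul1r. Qed.

Lemma additive_nextP t : additive_edge t -> additive_edge (additive_next t).
Proof. by case: t => [[y z] s] /andP[sS _]; apply: additive_edge_add. Qed.

Lemma multiplicative_nextP t :
  multiplicative_edge t -> multiplicative_edge (multiplicative_next t).
Proof.
case: t => [[y z] s] /and4P[y0 z0 sS /eqP sE]; apply: multiplicative_edge_mul => //.
(* The edge itself shows that [s] is nonzero, as a quotient of nonzero elements. *)
by rewrite -sE mulf_neq0 ?invr_eq0.
Qed.

Definition next_edge e : Xf_edge fI :=
  match e with
  | inl a => inl (Sub (additive_next (val a)) (additive_nextP (valP a)))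
  | inr m => inr (Sub (multiplicative_next (val m)) (multiplicative_nextP (valP m)))
  end.

(** The target [z] and the label [s] determine the source, as [z - s] or [z / s], and [next_edge]
    retains both. *)
Lemma next_edge_inj : injective next_edge.
Proof.
move=> [[[[y z] s] a]|[[[y z] s] a]] [[[[y' z'] s'] a']|[[[y' z'] s'] a']] //=.
  case=> zz _ ss; congr inl; apply: val_inj => /=.
  move: a a' => /= /andP[_ /eqP a] /andP[_ /eqP a'].
  rewrite -zz -ss (_ : y = y') //; apply: oppr_inj; apply: (addrI z).
  by rewrite a {1}zz a'.
case=> zz _ ss; congr inr; apply: val_inj => /=.
move: a a' => /= /and4P[_ z0 _ /eqP a] /and4P[_ z0' _ /eqP a'].
rewrite -zz -ss (_ : y = y') //; apply: invr_inj; apply: (mulfI z0).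
by rewrite a {1}zz a'.
Qed.

Definition next_perm : {perm dedge (directed_Xf fI)} := perm next_edge_inj.

Lemma next_perm_succession : is_succession next_perm.
Proof. by apply/forallP=> -[] a; rewrite permE. Qed.

Lemma walk_within_add y s : s \in S_f fI -> @walk_within G y (y + s) 1.
Proof.
move=> sS; exact: (@walk_within_edge G (inl (Sub _ (additive_edge_add y sS)))).
Qed.

Lemma walk_within_mul y s :
  s \in S_f fI -> s != 0 -> y != 0 -> @walk_within G y (y * s) 1.
Proof.
move=> sS s0 y0.
exact: (@walk_within_edge G (inr (Sub _ (multiplicative_edge_mul sS s0 y0)))).
Qed.

Lemma walk_within_muln y s n : s \in S_f fI -> @walk_within G y (y + s *+ n) n.
Proof.
move=> sS; elim: n => [|n IH]; first by rewrite mulr0n addr0; apply: walk_within_refl.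
rewrite mulrSr addrA -addn1; exact: walk_within_trans IH (walk_within_add _ sS).
Qed.

Lemma clsD q r : cls (q + r) = cls q + cls r.
Proof. exact: (rmorphD (in_qpoly (monic_of f))). Qed.

Lemma clsM q r : cls (q * r) = cls q * cls r.
Proof. exact: (rmorphM (in_qpoly (monic_of f))). Qed.

Lemma cls_nat n : cls n%:R = n%:R.
Proof. exact: (rmorph_nat (in_qpoly (monic_of f))). Qed.

Lemma size_mk_monic_of : size (mk_monic (monic_of f)) = size f.
Proof.
(* [mk_monic] falls back to ['X] unless its argument is monic and nonconstant. *)
have [[h1 _] hm] := monic_of_irreducible fI.
rewrite /mk_monic h1 hm /= size_scale // invr_eq0 lead_coef_eq0.
by case: fI => + _; apply: contraTneq => ->; rewrite size_poly0.
Qed.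

Lemma cls_surj y : exists2 q, y = cls q & (size q < size f)%N.
Proof.
have sy : (size (val y) < size f)%N.
  by rewrite -[ltnRHS]size_mk_monic_of; apply: size_mk_monic.
exists (val y) => //; apply/val_inj/esym/in_qpoly_small.
by rewrite [ltnRHS]size_mk_monic_of.
Qed.

Lemma cls_eq0 q : (size q < size f)%N -> (cls q == 0) = (q == 0).
Proof.
rewrite -size_mk_monic_of => sq; apply/eqP/eqP=> [q0 | ->]; last exact: rmorph0.
by rewrite -(in_qpoly_small sq) -[in_qpoly _ _]/(cls q) q0.
Qed.

Hypothesis pP : prime p.
Hypothesis f2 : (2 < size f)%N.

Lemma pchar_Kf : p \in [pchar K].
Proof. by rewrite inE pP -cls_nat -polyC_natr pchar_Fp_0 // [cls _]rmorph0 eqxx. Qed.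

Lemma x_in_S : x \in S_f fI.
Proof.
have k0 : (0 < (size f).-1)%N by lia.
by apply/imsetP; exists (Ordinal k0); rewrite //= expr1.
Qed.

(** In degree at least two, ['X] is its own reduced representative; likewise ['X - 1] below. *)
Lemma x_neq0 : x != 0.
Proof. by rewrite [_ == _]cls_eq0 ?size_polyX ?polyX_eq0. Qed.

Lemma x_neq1 : x != 1.
Proof.
rewrite -subr_eq0 (_ : x - 1 = cls ('X - 1%:P)).
  by rewrite cls_eq0 ?size_XsubC ?polyXsubC_eq0.
by rewrite /cls rmorphB rmorph1.
Qed.

Lemma S_neq0 s : s \in S_f fI -> s != 0.
Proof. by case/imsetP=> i _ ->; rewrite expf_neq0 ?x_neq0. Qed.

Lemma S_neq1 s : s \in S_f fI -> s != 1.
Proof. by case/imsetP=> i _ ->; rewrite expf_pchar_eq1 ?pchar_Kf ?x_neq1. Qed.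

Lemma noloop_Xf (e : dedge (directed_Xf fI)) : src e != tgt e.
Proof.
case: e => -[[[y z] s] /=].
  case/andP=> /S_neq0 s0 /eqP zs; rewrite eq_sym -subr_eq0 zs //.
case/and4P=> y0 _ /S_neq1 s1 /eqP zs; rewrite eq_sym.
by apply: contraNneq s1 => zy; rewrite -zs zy divff.
Qed.

Lemma has_girth2_Xf : has_girth G 2.
Proof.
have x1 : x - 1 != 0 by rewrite subr_eq0 x_neq1.
pose y : K := x / (x - 1).
have y0 : y != 0 by rewrite mulf_neq0 ?invr_eq0 ?x_neq0.
have yx : y + x = y * x.
  by rewrite -{1}(divfK x1 x) -/y mulrBr mulr1 addrC subrK.
have ae := additive_edge_add y x_in_S.
have me : multiplicative_edge (y, y + x, x).
  by rewrite yx; apply: multiplicative_edge_mul; rewrite ?x_in_S ?x_neq0.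
apply: (@has_girth2_of_parallel (directed_Xf fI) (inl (Sub _ ae)) (inr (Sub _ me))) => //.
exact: noloop_Xf.
Qed.

(** With [n = size q] coefficients, Horner's scheme costs at most [n * (p - 1)] additions and
    [n - 1] multiplications, together [n * p - 1]. The factor [x] turns a coefficient [c] into [c]
    additions of [x]. *)
Lemma walk_within_Horner q :
  (size q < size f)%N -> @walk_within G 0 (x * cls q) (size q * p).-1.
Proof.
have p1 := prime_gt1 pP.
have consts (c : 'F_p) : x * cls c%:P = x *+ c /\ (c <= p.-1)%N.
  rewrite -{1}[c]natr_Zp polyC_natr cls_nat mulr_natr; split=> //.
  by rewrite -ltnS prednK ?(ltnW p1) // -{2}(Fp_cast pP).
elim/poly_ind: q => [|q c IH] sq.
  rewrite [cls 0]rmorph0 mulr0; exact: walk_within_refl.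
have [xc cp] := consts c.
rewrite clsD clsM mulrDr xc.
(* For [q = 0] the walk is still at 0, where no multiplicative edge starts, so the leading
   coefficient is handled by additions alone. *)
have [q0 | q0] := eqVneq q 0.
  rewrite q0 [cls 0]rmorph0 mul0r mulr0 mul0r !add0r size_polyC.
  have [-> | c0] := eqVneq c 0; first by rewrite mulr0n; apply: walk_within_refl.
  rewrite mul1n -[_ *+ _]add0r.
  exact: walk_within_leq cp (walk_within_muln _ _ x_in_S).
have sqc : size (q * 'X + c%:P) = (size q).+1 by rewrite size_MXaddC (negPf q0).
rewrite sqc in sq *; have qf : (size q < size f)%N by apply: ltnW.
have q_gt0 : (0 < size q)%N by rewrite size_poly_gt0.
apply: (@walk_within_leq _ _ _ ((size q * p).-1 + 1 + c)).
  have : (0 < size q * p)%N by rewrite muln_gt0 q_gt0 ltnW.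
  by rewrite mulSn; lia.
apply: walk_within_trans (walk_within_muln _ _ x_in_S).
apply: walk_within_trans (IH qf) _; rewrite mulrA.
by apply: walk_within_mul; rewrite ?x_in_S ?x_neq0 // mulf_neq0 ?x_neq0 ?cls_eq0.
Qed.

Lemma walk_within_Xf y z :
  @walk_within G y z ((((size f).-1 * p).-1).*2).
Proof.
have from0 v : @walk_within G 0 v ((size f).-1 * p).-1.
  have [q vq sq] := cls_surj (x^-1 * v).
  (* Expanding [v / x] instead of [v] supplies the factor [x] that Horner's scheme produces. *)
  have -> : v = x * cls q by rewrite -vq mulVKf ?x_neq0.
  apply: walk_within_leq (walk_within_Horner sq).
  have : (size q * p <= (size f).-1 * p)%N by rewrite leq_mul2r; lia.
  by lia.
rewrite -addnn; apply: walk_within_trans (walk_within_sym (from0 y)) (from0 z).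
Qed.

End QuotientFieldGraph.

Theorem mainTheorem1 (p k : nat) (f : {poly 'F_p}) (fI : irreducible_poly f) :
  prime p -> 2 <= k -> size f = k.+1 ->
  connected (Xf fI) /\
  eulerian (Xf fI) /\
  has_girth (Xf fI) 2 /\
  exists2 d, has_diameter (Xf fI) d
           & d <= 2 * p * (2 * k + 1) - 2 * k - 4.
Proof.
move=> pP k2 sf.
have f2 : 2 < size f by rewrite sf.
have walks := walk_within_Xf (fI := fI) pP f2.
have conn : connected (Xf fI).
  by move=> u v; have [w pw _] := walk_within_path (walks u v); exists w.
have e0 : additive_edge (0, x_f fI, x_f fI)%R.
  by rewrite /= x_in_S ?subr0 ?eqxx.
split=> //; split.
  have succ := next_perm_succession fI.
  exact: (@eulerian_of_succession (directed_Xf fI) _ (inl (Sub _ e0)) succ conn).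
split; first exact: has_girth2_Xf.
have [d dd dle] := @walk_within_diameter (Xf fI) (x_f fI) _ walks.
exists d => //; apply: leq_trans dle _.
(* This says that the slack [2 * (p - 1) * (k + 1)] in the bound is nonnegative. *)
have : k.+1 <= p * k.+1 by rewrite leq_pmull ?prime_gt0.
by rewrite sf -muln2 mulnS; have := prime_gt1 pP; nia.
Qed.
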